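(* Let $(X,\|\cdot\|)$ be a real normed space, let $X_o=X\setminus\{o\}$, and let $\mathrm{ang_i}:X_o\times X_o\to\mathbb{R}$ be its I-angle, $$\mathrm{ang_i}(x,y)=\arccos\left(\frac{\|x+y\|^2-\|x-y\|^2}{4\|x\|\,\|y\|}\right).$$ Then $\mathrm{ang_i}$ is homogeneous, i.e. $\mathrm{ang_i}(\alpha x,\beta y)=\mathrm{ang_i}(x,y)$ for all $x,y\in X_o$ and all $\alpha,\beta>0$, if and only if the norm $\|\cdot\|$ is Euclidean, i.e. derived from an inner product.
   Context: $\arccos:[-1,1]\to[0,\pi]$ is the usual inverse cosine. ''Derived from an inner product'' means that there is an inner product $(\cdot,\cdot)$ on $X$ with $\|x\|^2=(x,x)$ for all $x\in X$. *)

(* Defs.v *)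
From HB Require Import structures.
From mathcomp Require Import all_boot all_order all_algebra.
From mathcomp Require Import all_classical all_reals all_analysis.

Set Implicit Arguments.
Unset Strict Implicit.
Unset Printing Implicit Defensive.

Import Order.TTheory GRing.Theory Num.Theory.
Import numFieldNormedType.Exports.

Local Open Scope ring_scope.

(* Meaningful for x, y != 0 only; the argument of acos then lies in [-1, 1]
   by the triangle inequality. *)
Definition I_angle (R : realType) (X : normedModType R) (x y : X) : R :=
  acos ((`|x + y| ^+ 2 - `|x - y| ^+ 2) / (4 * `|x| * `|y|)).

(* Functions on (X \ {0}) x (X \ {0}) are represented by functions on X x X
   whose values at 0 are irrelevant. *)
Definition homogeneous_angle (R : realType) (X : normedModType R)
    (ang : X -> X -> R) : Prop :=
  forall x y : X, x != 0 -> y != 0 ->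
  forall a b : R, 0 < a -> 0 < b -> ang (a *: x) (b *: y) = ang x y.

Definition euclidean_norm (R : realType) (X : normedModType R) : Prop :=
  exists dot : {dot X for @idfun R}, forall x : X, `|x| ^+ 2 = dot x x.

(* Main.v *)
Require Import Defs.
From HB Require Import structures.
From mathcomp Require Import all_boot all_order all_algebra.
From mathcomp Require Import all_classical all_reals all_analysis.
From mathcomp Require Import ring lra.

(** Put B(x, y) = |x + y|^2 - |x - y|^2.  Since arccos is injective, the I-angle
    is homogeneous iff B is homogeneous in each variable.  In that case, fix x, y
    and let F(s) = |x + s y|^2 + |x - s y|^2, an even function.  Homogeneity of B
    at the base points x + s y and x - s y yields
    F(s + t) - F(s - t) = t H(s) for some function H; as F is even, the left-hand
    side is symmetric in s and t, so H is linear and F(s) = F(0) + c s^2.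
    Exchanging the roles of x and y identifies c = 2 |y|^2, which is the
    parallelogram law, and B / 4 is then an inner product (Jordan-von Neumann). *)

Set Implicit Arguments.
Unset Strict Implicit.
Unset Printing Implicit Defensive.

Import Order.TTheory GRing.Theory Num.Theory.
Import numFieldNormedType.Exports.

Local Open Scope ring_scope.

Lemma even_quadratic (R : realFieldType) (F H : R -> R) :
  (forall s, F (- s) = F s) ->
  (forall s t, F (s + t) - F (s - t) = t * H s) ->
  forall s, F s = F 0 + s ^+ 2 * (F 1 - F 0).
Proof.
move=> evenF FH.
have H_linear s : H s = s * H 1.
  by rewrite -[LHS]mul1r -!FH [1 + s]addrC -(evenF (1 - s)) opprB.
(* On the diagonal [t = s] the difference equation gives [F] at [s + s]; halving the argument then
   reaches every point. *)
have Fdouble s : F (s + s) - F 0 = s ^+ 2 * H 1.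
  by have := FH s s; rewrite subrr H_linear mulrA expr2.
have Fs s : F s - F 0 = (s / 2) ^+ 2 * H 1 by rewrite -Fdouble -splitr.
by move=> s; rewrite Fs; have := Fs s; lra.
Qed.

Section PolarForm.
Variables (R : realType) (X : normedModType R).
Implicit Types (x y z : X) (a b s t : R).

Definition norm_polar x y : R := `|x + y| ^+ 2 - `|x - y| ^+ 2.

Lemma norm_polarC x y : norm_polar x y = norm_polar y x.
Proof. by rewrite /norm_polar [x + y]addrC distrC. Qed.

Lemma norm_polarNl x y : norm_polar (- x) y = - norm_polar x y.
Proof.
by rewrite /norm_polar opprB [- x + y]addrC distrC -opprD normrN.
Qed.

Lemma norm_polar0l y : norm_polar 0 y = 0.
Proof. by rewrite /norm_polar add0r sub0r normrN subrr. Qed.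

Lemma norm_polarxx x : norm_polar x x = 4 * `|x| ^+ 2.
Proof.
rewrite /norm_polar subrr normr0 -mulr2n normrMn; lra.
Qed.

(** Both [x + y] and [x - y] have norm between [| |x| - |y| |] and [|x| + |y|], and the squares of
    these bounds differ by [4 |x| |y|]. This puts the argument of [acos] in [-1, 1], where [cos]
    undoes [acos]. *)
Lemma norm_polar_bound x y : `|norm_polar x y| <= 4 * `|x| * `|y|.
Proof.
have h1 := ler_normD x y; have h2 := ler_normB x y.
have h3 := ler_dist_dist x y.
have h4 := ler_dist_dist x (- y); rewrite opprK normrN in h4.
have bound u v : `|u| <= `|x| + `|y| -> `| `|x| - `|y| | <= `|v| ->
    `|u : X| ^+ 2 - `|v : X| ^+ 2 <= 4 * `|x| * `|y|.
  move=> hu hv.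
  have hu2 : `|u| ^+ 2 <= (`|x| + `|y|) ^+ 2 by rewrite lerXn2r ?nnegrE ?addr_ge0.
  have hv2 : `| `|x| - `|y| | ^+ 2 <= `|v| ^+ 2 by rewrite lerXn2r ?nnegrE.
  move: hv2; rewrite real_normK ?num_real // => hv2; nra.
rewrite ler_norml lerNl opprB; apply/andP; split; exact: bound.
Qed.

Lemma norm_polar_homogeneous : homogeneous_angle (@I_angle R X) ->
  forall a x y, norm_polar (a *: x) y = a * norm_polar x y.
Proof.
move=> hom.
have hpos a x y : 0 < a -> norm_polar (a *: x) y = a * norm_polar x y.
  move=> a0.
  have [->|x0] := eqVneq x 0; first by rewrite scaler0 norm_polar0l mulr0.
  have [->|y0] := eqVneq y 0.
    by rewrite !(norm_polarC _ 0) !norm_polar0l mulr0.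
  have := hom x y x0 y0 a 1 a0 ltr01; rewrite scale1r /I_angle => /(congr1 cos).
  have dom u v : u != 0 -> v != 0 ->
      norm_polar u v / (4 * `|u| * `|v|) \in `[(-1), 1].
    move=> u0 v0; have d0 : 0 < 4 * `|u| * `|v| by rewrite !mulr_gt0 ?normr_gt0.
    rewrite in_itv /= -ler_norml normrM normfV (gtr0_norm d0).
    by rewrite ler_pdivrMr // mul1r norm_polar_bound.
  rewrite !acosK ?dom ?scaler_eq0 ?(gt_eqF a0) //.
  rewrite -!/(norm_polar _ _) normrZ (gtr0_norm a0).
  have nx0 : `|x| != 0 by rewrite normr_eq0.
  have ny0 : `|y| != 0 by rewrite normr_eq0.
  have a_neq0 : a != 0 by rewrite gt_eqF.
  have d0 : 4 * (a * `|x|) * `|y| != 0 by rewrite !mulf_neq0 // pnatr_eq0.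
  move=> e; rewrite -[LHS](divfK d0) e; field.
  by rewrite nx0 ny0.
(* Angle homogeneity only covers positive scalars; negative ones follow because the form is odd in
   [x]. *)
move=> a x y; have [a0|a0|->] := ltrgt0P a; first exact: hpos.
  by rewrite -[a]opprK scaleNr norm_polarNl hpos ?oppr_gt0 // [RHS]mulNr.
by rewrite scale0r norm_polar0l mul0r.
Qed.

Hypothesis polarZl : forall a x y, norm_polar (a *: x) y = a * norm_polar x y.

Lemma norm_polarZr a x y : norm_polar x (a *: y) = a * norm_polar x y.
Proof. by rewrite norm_polarC polarZl norm_polarC. Qed.

Lemma norm_line_quadratic x y : exists c, forall s,
  `|x + s *: y| ^+ 2 + `|x - s *: y| ^+ 2 = 2 * `|x| ^+ 2 + s ^+ 2 * c.
Proof.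
pose F s := `|x + s *: y| ^+ 2 + `|x - s *: y| ^+ 2.
pose H s := norm_polar (x + s *: y) y - norm_polar (x - s *: y) y.
have evenF s : F (- s) = F s by rewrite /F scaleNr opprK addrC.
(* Moving [t] into the second argument gives [norm_polar (x + s *: y) (t *: y) - norm_polar (x - s
   *: y) (t *: y)], whose four squares are those of [F (s + t)] and [F (s - t)]. *)
have FH s t : F (s + t) - F (s - t) = t * H s.
  rewrite mulrBr -!norm_polarZr /F /norm_polar.
  rewrite scalerBl scalerDl opprD opprB !addrA.
  rewrite [x + t *: y - s *: y]addrAC; lra.
have F0 : F 0 = 2 * `|x| ^+ 2 by rewrite /F scale0r subr0 addr0; lra.
by exists (F 1 - F 0) => s; rewrite -F0 -(even_quadratic evenF FH).
Qed.

Lemma parallelogram_law x y :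
  `|x + y| ^+ 2 + `|x - y| ^+ 2 = 2 * `|x| ^+ 2 + 2 * `|y| ^+ 2.
Proof.
have [c xy] := norm_line_quadratic x y.
have [d yx] := norm_line_quadratic y x.
have swap s : s != 0 -> `|x + s *: y| ^+ 2 + `|x - s *: y| ^+ 2 =
    s ^+ 2 * (`|y + s^-1 *: x| ^+ 2 + `|y - s^-1 *: x| ^+ 2).
  move=> s0; rewrite [`|y - _|]distrC [y + _]addrC -[s ^+ 2]real_normK ?num_real //.
  rewrite mulrDr -!exprMn -!normrZ scalerDr scalerBr.
  by rewrite scalerA divff // scale1r.
(* These read [2|x|^2 + c = 2|y|^2 + d] and [2|x|^2 + 4c = 8|y|^2 + d]; subtracting eliminates [d]
   and gives [c = 2|y|^2]. *)
have e1 := swap 1 (oner_neq0 _); have e2 := swap 2 ltac:(by rewrite pnatr_eq0).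
move: e1 e2; rewrite !xy !yx => e1 e2.
have := xy 1; rewrite scale1r => ->.
move: e1 e2; rewrite invr1 exprVn; lra.
Qed.

(** The parallelogram laws for [x + y, z + y] and for [x - y, z - y] share the term [|x - z|^2].
    Their difference expresses [norm_polar (x + z) (2 *: y)], and homogeneity removes the 2. *)
Lemma norm_polarDl x z y :
  norm_polar (x + z) y = norm_polar x y + norm_polar z y.
Proof.
have := norm_polarZr 2 (x + z) y; rewrite /norm_polar.
have := parallelogram_law (x + y) (z + y).
have := parallelogram_law (x - y) (z - y).
rewrite [x - y + _]addrACA [x + y + _]addrACA.
rewrite !(opprD, opprK) [x - y + (- z + _)]addrACA [x + y + (- z - _)]addrACA.
rewrite addNr subrr addr0 -opprD -mulr2n -scaler_nat; lra.
Qed.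

Lemma euclidean_norm_polar : euclidean_norm X.
Proof.
pose f x y : R := norm_polar x y / 4.
have fxx x : f x x = `|x| ^+ 2 by rewrite /f norm_polarxx; lra.
have fC x y : f x y = f y x by rewrite /f norm_polarC.
have fl z : GRing.linear_for *%R (f^~ z).
  by move=> a x y; rewrite /f norm_polarDl polarZl; lra.
have fr z : GRing.linear_for (@idfun R \; *%R) (f z).
  by move=> a x y; rewrite !(fC z) fl.
pose f_bil := bilinear_isBilinear.Build R X X R *%R (@idfun R \; *%R) f (fl, fr).
have f_herm x y : f x y = (-1) ^+ false * idfun (f y x) by rewrite expr0 mul1r fC.
have f_pos x : x != 0 -> 0 < f x x by move=> x0; rewrite fxx exprn_gt0 // normr_gt0.
pose mh := isHermitianSesquilinear.Build R X false (@idfun R) f f_herm.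
pose mp := isDotProduct.Build R X f f_pos.
pose dot : {dot X for @idfun R} := HB.pack f f_bil mh mp.
by exists dot => x; rewrite -fxx.
Qed.

End PolarForm.

(** By polarization the quotient inside [acos] is [dot x y / (|x| |y|)], where positive scalars
    cancel. *)
Lemma euclidean_homogeneous_angle (R : realType) (X : normedModType R) :
  euclidean_norm X -> homogeneous_angle (@I_angle R X).
Proof.
move=> [dot dotE] x y x0 y0 a b a0 b0.
have polarE u v : `|u + v| ^+ 2 - `|u - v| ^+ 2 = 4 * dot u v.
  have dotC : dot v u = dot u v by rewrite hermC expr0 mul1r.
  rewrite !dotE linearDl linearBl !linearDr /= !linearNr dotC; lra.
rewrite /I_angle !polarE !normrZ !gtr0_norm // (linearZl_LR dot) (linearZr_LR dot) /=.
congr acos; field.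
by rewrite !normr_eq0 x0 y0 !gt_eqF.
Qed.

Theorem proposition3p2p1 (R : realType) (X : normedModType R) :
  homogeneous_angle (@I_angle R X) <-> euclidean_norm X.
Proof.
split; last exact: euclidean_homogeneous_angle.
by move=> /norm_polar_homogeneous; exact: euclidean_norm_polar.
Qed.
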